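(* Let $r$ and $t$ be positive integers and let $G$ be a simple graph. Then $G$ is isomorphic to the double star $S_{r,t}$ if and only if both $$[x]\,da(G;x,y) = (r+t)y^{r+t+1}+y^{r+1}+y^{t+1}\quad\text{and}\quad [x^{r+t+2}]\,da(G;x,y) = y^{r+t+3}.$$
   Context: All graphs are finite, simple and have at least one vertex. For a graph $G$, $S\subseteq V(G)$ and $u\in V(G)$, let $\bar S=V(G)\setminus S$, let $\delta_S(u)=|\{v\in S:\{u,v\}\in E(G)\}|$, and let $G[S]$ be the subgraph induced by $S$. The defensive alliance polynomial of $G$ is $$da(G;x,y)=\sum_{S} x^{|S|}\,y^{f_y(S)},\qquad f_y(S)=\min_{u\in S}\bigl(\delta_S(u)-\delta_{\bar S}(u)+|V(G)|\bigr),$$ where the sum runs over all non-empty $S\subseteq V(G)$ such that $G[S]$ is connected (single-vertex graphs are connected). $[x^k]\,da(G;x,y)$ denotes the coefficient of $x^k$ in $da(G;x,y)$, which is a polynomial in $y$. The star $S_n$ is the graph with one center vertex adjacent to $n$ pairwise non-adjacent vertices. The double star $S_{r,t}$ is obtained from the disjoint union of the stars $S_r$ and $S_t$ by adding an edge between their two centers (so it has $r+t+2$ vertices). *)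

(* Defs.v *)
From HB Require Import structures.
From mathcomp Require Import all_boot all_order all_algebra.

Set Implicit Arguments.
Unset Strict Implicit.
Unset Printing Implicit Defensive.

Import GRing.Theory.

Record sgraph := SGraph {
  vertex :> finType;
  edge : rel vertex;
  edge_sym : symmetric edge;
  edge_irrefl : irreflexive edge }.

Definition graph_iso (G H : sgraph) : Prop :=
  exists2 f : G -> H, bijective f & {mono f : u v / edge u v}.

Definition connected (G : sgraph) : bool :=
  [forall u : G, forall v : G, connect (@edge G) u v].

Section Constructions.

Variables G H : sgraph.

Section Induced.
Variable S : {set G}.
Definition induced_edge : rel {u : G | u \in S} :=
  fun u v => edge (val u) (val v).
Fact induced_sym : symmetric induced_edge.
Proof. by move=> u v; apply: edge_sym. Qed.
Fact induced_irrefl : irreflexive induced_edge.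
Proof. by move=> u; apply: edge_irrefl. Qed.
Definition induced : sgraph := SGraph induced_sym induced_irrefl.
End Induced.

Definition union_edge : rel (G + H)%type := fun u v =>
  match u, v with
  | inl a, inl b => edge a b
  | inr a, inr b => edge a b
  | _, _ => false
  end.
Fact union_sym : symmetric union_edge.
Proof. by case=> a [] b //=; apply: edge_sym. Qed.
Fact union_irrefl : irreflexive union_edge.
Proof. by case=> a /=; apply: edge_irrefl. Qed.
Definition disjoint_union : sgraph := SGraph union_sym union_irrefl.

(* The test [u != v] keeps the graph loopless in the degenerate case a = b. *)
Definition added_edge (a b : G) : rel G := fun u v =>
  edge u v || (u != v) && ((u == a) && (v == b) || (u == b) && (v == a)).
Fact added_sym a b : symmetric (added_edge a b).
Proof.
move=> u v; rewrite /added_edge edge_sym eq_sym.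
by rewrite [(v == a) && _]andbC [(v == b) && _]andbC [in RHS](orbC (_ && _)).
Qed.
Fact added_irrefl a b : irreflexive (added_edge a b).
Proof. by move=> u; rewrite /added_edge edge_irrefl eqxx. Qed.
Definition add_edge (a b : G) : sgraph :=
  SGraph (added_sym a b) (added_irrefl a b).

End Constructions.

(* The centre is [None]; the leaves are [Some i] for i < n. *)
Definition star_edge (n : nat) : rel (option 'I_n) :=
  fun u v => isSome u (+) isSome v.
Fact star_sym n : symmetric (@star_edge n).
Proof. by move=> u v; apply: addbC. Qed.
Fact star_irrefl n : irreflexive (@star_edge n).
Proof. by move=> u; apply: addbb. Qed.
Definition star (n : nat) : sgraph := SGraph (@star_sym n) (@star_irrefl n).
Definition star_center (n : nat) : star n := None.

Definition double_star (r t : nat) : sgraph :=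
  @add_edge (disjoint_union (star r) (star t))
    (inl (star_center r)) (inr (star_center t)).

Section AlliancePolynomial.

Variable G : sgraph.
Implicit Types (S : {set G}) (u : G).

Definition delta S u : nat := #|[set v in S | edge u v]|.

(* Reordered so that the subtraction never truncates: see [local_indexE]. *)
Definition local_index S u : nat := delta S u + #|G| - delta (~: S) u.

Lemma local_indexE S u :
  ((local_index S u)%:Z = (delta S u)%:Z - (delta (~: S) u)%:Z + #|G|%:Z)%R.
Proof.
have le : delta (~: S) u <= delta S u + #|G|.
  exact: leq_trans (max_card _) (leq_addl _ _).
by rewrite /local_index -subzn // PoszD addrAC.
Qed.

(* The minimum of [local_index S u] over u in S; it is 0 by convention for
   S = set0, which does not occur in [da]. *)
Definition f_y S : nat :=
  if [pick u in S] is Some u0 then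
    local_index S [arg min_(u < u0 in S) local_index S u]
  else 0.

Lemma f_yP S : S != set0 ->
  (exists2 u, u \in S & f_y S = local_index S u) /\
  (forall u, u \in S -> f_y S <= local_index S u).
Proof.
move=> /set0Pn[w wS]; rewrite /f_y; case: pickP => [u0 u0S|/(_ w)]; last first.
  by rewrite /= wS.
by case: arg_minnP => // u uS umin; split=> //; exists u.
Qed.

(* The outer variable of {poly {poly int}} is x and the inner one is y, so
   that [(da G)`_k] is the coefficient of x^k, a polynomial in y. *)
Definition da : {poly {poly int}} :=
  (\sum_(S : {set G} | (S != set0) && connected (induced S))
     'X^#|S| * ('X^(f_y S))%:P)%R.

End AlliancePolynomial.

(* Main.v *)
(** The singletons give [x] da = sum_v y^(n - deg v), so this coefficient encodes
    the order n (at y = 1) and the degree sequence, while the coefficient of x^n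
    is nonzero exactly when G is connected.  A connected graph with r + t
    vertices of degree 1 and two vertices a, b of degrees r + 1, t + 1 is a
    double star: two adjacent leaves would form a component of their own, so
    every leaf hangs from a or b, and a, b are adjacent, since otherwise a and
    its neighbours would be a component missing b. *)
Require Import Defs.
From mathcomp Require Import all_boot all_order all_algebra.
From mathcomp Require Import zify.

Set Implicit Arguments.
Unset Strict Implicit.
Unset Printing Implicit Defensive.

Import GRing.Theory Num.Theory.

(** * Isomorphisms and connectedness *)

Lemma graph_iso_sym (G H : sgraph) : graph_iso G H -> graph_iso H G.
Proof.
case=> f [g fK gK] fE; exists g; first by exists f.
by move=> u v; rewrite -fE !gK.
Qed.

Lemma connected_iso (G H : sgraph) :
  graph_iso G H -> connected G -> connected H.
Proof.
case=> f [g fK gK] fE /forallP conG; apply/forallP=> u; apply/forallP=> v.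
have /forallP/(_ (g v))/connectP[p gp vE] := conG (g u).
apply/connectP; exists (map f p); last by rewrite -[u]gK last_map -vE gK.
by rewrite -[u]gK (homo_path _ gp) // => x y; rewrite fE.
Qed.

Lemma induced_setT_iso (G : sgraph) : graph_iso (induced [set: G]) G.
Proof.
exists val => //.
by exists (fun u => exist _ u (in_setT u)) => // u; apply: val_inj.
Qed.

Lemma connected_set1 (G : sgraph) (v : G) : connected (induced [set v]).
Proof.
apply/forallP=> -[x xv]; apply/forallP=> -[y yv].
by rewrite (_ : exist _ x xv = exist _ y yv) //; apply: val_inj;
  rewrite /= (set1P xv) (set1P yv).
Qed.

(** * Degrees, as alliance counts towards the whole vertex set *)

Local Notation degree := (delta [set: _]).

Lemma degreeE (G : sgraph) (u : G) : degree u = \sum_v edge u v.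
Proof.
rewrite /delta -sum1_card big_mkcond; apply: eq_bigr => v _.
by rewrite !inE; case: edge.
Qed.

Lemma degree_iso (G H : sgraph) (f : G -> H) (u : G) :
  bijective f -> {mono f : u v / edge u v} -> degree (f u) = degree u.
Proof.
move=> bij_f fE; rewrite !degreeE (reindex f) /=; last exact: onW_bij.
by apply: eq_bigr => v _; rewrite fE.
Qed.

Lemma degree_lt (G : sgraph) (u : G) : degree u < #|G|.
Proof.
rewrite -cardsT; apply: proper_card; apply/properP; split; first exact: subsetT.
by exists u; rewrite !inE // edge_irrefl.
Qed.

(** * Order, degrees and connectedness of the double star *)

Lemma big_option (R : Type) (idx : R) (op : Monoid.com_law idx) (T : finType)
    (F : option T -> R) :
  \big[op/idx]_x F x = op (F None) (\big[op/idx]_t F (Some t)).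
Proof.
rewrite (bigD1 None) //= (reindex_omap Some id) => [|[]//].
by congr (op _ _); apply: eq_bigl => t; rewrite eqxx.
Qed.

(** Separates the four kinds of vertices, so that degree sums and the coefficient of x are computed
    kind by kind. *)
Lemma big_double_star (R : Type) (idx : R) (op : Monoid.com_law idx) (r t : nat)
    (F : double_star r t -> R) :
  \big[op/idx]_v F v =
  op (op (F (inl None)) (\big[op/idx]_(i < r) F (inl (Some i))))
     (op (F (inr None)) (\big[op/idx]_(i < t) F (inr (Some i)))).
Proof.
by rewrite (@big_sumType _ _ _ (option 'I_r) (option 'I_t)) !big_option.
Qed.

Lemma card_double_star (r t : nat) : #|double_star r t| = r + t + 2.
Proof. by rewrite card_sum !card_option !card_ord; lia. Qed.

Lemma degree_double_star (r t : nat) (v : double_star r t) :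
  degree v =
  match v with inl None => r.+1 | inr None => t.+1 | _ => 1 end.
Proof.
rewrite degreeE big_double_star.
case: v => [[i|]|[i|]]; rewrite /= /added_edge /= ?sum_nat_const ?card_ord.
all: by rewrite ?big1 => *; rewrite ?andbF //; lia.
Qed.

Lemma connected_double_star (r t : nat) : connected (double_star r t).
Proof.
have conn0 (v : double_star r t) : connect (@edge _) (inl None : double_star r t) v.
  case: v => [[i|]|[i|]] //; try exact: connect1.
  (* Only the leaves of the second star remain; they are reached through its centre. *)
  by apply: (@connect_trans _ _ (inr None : double_star r t)); apply: connect1.
apply/forallP=> u; apply/forallP=> v; apply: connect_trans (conn0 v).
by rewrite (sym_connect_sym (@edge_sym _)).
Qed.

(** * Local indices on singletons and on the whole vertex set *)

(** Without loops, every neighbour of [u] lies outside the singleton. *)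
Lemma local_index_set1 (G : sgraph) (u : G) :
  local_index [set u] u = #|G| - degree u.
Proof.
rewrite /local_index (_ : delta [set u] u = 0); last first.
  apply/eqP; rewrite cards_eq0; apply/eqP/setP=> v; rewrite !inE.
  by case: eqP => // ->; rewrite edge_irrefl.
congr (_ - _); apply: eq_card => v; rewrite !inE.
by case: eqP => // ->; rewrite edge_irrefl.
Qed.

Lemma local_index_setT (G : sgraph) (u : G) :
  local_index setT u = degree u + #|G|.
Proof.
rewrite /local_index setCT (_ : delta set0 u = 0) ?subn0 //.
by apply/eqP; rewrite cards_eq0; apply/eqP/setP=> v; rewrite !inE.
Qed.

Lemma f_y_set1 (G : sgraph) (u : G) : f_y [set u] = #|G| - degree u.
Proof.
have [|[v /set1P-> ->] _] := @f_yP G [set u]; last exact: local_index_set1.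
by apply/set0Pn; exists u; rewrite inE.
Qed.

(** * Coefficients of the alliance polynomial *)

Section AllianceCoefficients.

Local Open Scope ring_scope.

Lemma coef_da (G : sgraph) (k : nat) :
  (da G)`_k =
  \sum_(S : {set G} | [&& S != set0, connected (induced S) & #|S| == k])
     'X^(f_y S).
Proof.
rewrite coef_sum.
rewrite (eq_bigr (fun S : {set G} => if #|S| == k then 'X^(f_y S) else 0)).
  by rewrite -big_mkcondr; apply: eq_bigl => S; rewrite andbA.
by move=> S _; rewrite coefMC coefXn eq_sym; case: eqP; rewrite ?mul1r ?mul0r.
Qed.

Lemma coef_da1 (G : sgraph) : (da G)`_1 = \sum_(v : G) 'X^(#|G| - degree v).
Proof.
rewrite coef_da (eq_bigl [in [set [set v] | v : G]]) => [|S].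
  rewrite big_imset => [|u v _ _]; last exact: set1_inj.
  by apply: eq_bigr => v _; rewrite f_y_set1.
apply/and3P/imsetP=> [[_ _ /cards1P[v ->]]|[v _ ->]]; first by exists v.
rewrite connected_set1 cards1; split=> //.
by apply/set0Pn; exists v; rewrite inE.
Qed.

(** The full vertex set is the only set of that size, so a single term can occur, and it occurs
    exactly when the graph is connected. *)
Lemma coef_da_card (G : sgraph) : (0 < #|G|)%N ->
  (da G)`_#|G| = if connected G then 'X^(f_y [set: G]) else 0.
Proof.
move=> G_gt0; rewrite coef_da.
have ->: connected G = connected (induced [set: G]).
  by apply/idP/idP; apply: connected_iso;
    [apply: graph_iso_sym|]; apply: induced_setT_iso.
have cardE (S : {set G}) :
    [&& S != set0, connected (induced S) & #|S| == #|G|] =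
    (S == setT) && connected (induced [set: G]).
  have ->: (#|S| == #|G|) = (S == setT).
    by rewrite eqEcard subsetT cardsT eqn_leq max_card.
  case: (S =P setT) => [->|_]; last by rewrite !andbF.
  by rewrite andbT -card_gt0 cardsT G_gt0.
case: ifP cardE => _ cardE; first by apply: big_pred1 => S; rewrite cardE andbT.
by apply: big_pred0 => S; rewrite cardE andbF.
Qed.

(** Monomials with coefficient 1 cannot cancel, so each coefficient counts the indices with that
    exponent. The next two lemmas pass from a nonzero coefficient to an index and back. *)
Lemma coef_sumXn (T : finType) (P : pred T) (g : T -> nat) (k : nat) :
  (\sum_(v | P v) 'X^(g v) : {poly int})`_k = #|[set v | P v & g v == k]|%:R.
Proof.
rewrite coef_sum -sum1_card natr_sum big_mkcond [RHS]big_mkcond /=.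
by apply: eq_bigr => v _; rewrite inE coefXn eq_sym; case: (P v); case: eqP.
Qed.

Lemma sumXn_exists (T : finType) (P : pred T) (g : T -> nat) (k : nat)
    (q : {poly int}) :
  \sum_(v | P v) 'X^(g v) = q -> q`_k != 0 -> exists2 v, P v & g v = k.
Proof.
move=> <-; rewrite coef_sumXn pnatr_eq0 -lt0n => /card_gt0P[v].
by rewrite inE => /andP[Pv /eqP]; exists v.
Qed.

Lemma sumXn_coef_neq0 (T : finType) (P : pred T) (g : T -> nat) (v : T)
    (q : {poly int}) :
  \sum_(v | P v) 'X^(g v) = q -> P v -> q`_(g v) != 0.
Proof.
move=> <- Pv; rewrite coef_sumXn pnatr_eq0 -lt0n.
by apply/card_gt0P; exists v; rewrite inE Pv eqxx.
Qed.

Lemma double_star_coef (r t : nat) (G : sgraph) : (0 < r)%N ->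
  graph_iso G (double_star r t) ->
  (da G)`_1 = (r + t)%:R * 'X^(r + t + 1) + 'X^(r + 1) + 'X^(t + 1)
  /\ (da G)`_(r + t + 2) = 'X^(r + t + 3).
Proof.
move=> r_gt0 GH; have [f bij_f fE] := graph_iso_sym GH.
have cardG : #|G| = (r + t + 2)%N.
  by rewrite -(bij_eq_card bij_f) card_double_star.
have degG v : degree (f v) = degree v by apply: degree_iso.
split.
  rewrite coef_da1 (reindex f) /=; last exact: onW_bij.
  rewrite big_double_star /=.
  rewrite !degG !degree_double_star.
  under eq_bigr do rewrite degG degree_double_star.
  under [X in _ + (_ + X)]eq_bigr do rewrite degG degree_double_star.
  rewrite !sumr_const !card_ord cardG.
  (* The exponents are order minus degree, so the two centres swap parameters: degree r + 1 gives
     exponent t + 1 and conversely. *)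
  have [-> -> ->] : [/\ r + t + 2 - r.+1 = t + 1, r + t + 2 - t.+1 = r + 1
     & r + t + 2 - 1 = r + t + 1]%N by split; lia.
  by rewrite mulr_natl mulrnDr addrACA addrC [X in _ + X = _]addrC addrA.
rewrite -cardG coef_da_card; last by rewrite cardG addn2.
rewrite (connected_iso (graph_iso_sym GH)) ?connected_double_star //; congr 'X^_.
(* A leaf, available since r is positive, bounds the minimum above by 1 plus the order; the absence
   of isolated vertices gives the matching lower bound. *)
have deg1 : degree (f (inl (Some (Ordinal r_gt0)))) = 1%N.
  by rewrite degG degree_double_star.
have [|[u _ fyE] fy_min] := @f_yP G setT.
  by rewrite -card_gt0 cardsT cardG addn2.
have := fy_min _ (in_setT (f (inl (Some (Ordinal r_gt0))))).
rewrite fyE !local_index_setT deg1.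
have : (0 < degree u)%N.
  case: bij_f => g _ gK; rewrite -[u]gK degG degree_double_star.
  by case: (g u) => [[]|[]].
by rewrite cardG; lia.
Qed.

End AllianceCoefficients.

(** * Recognising a double star *)

(** The isomorphism sends centres to [a] and [b] and enumerates the other neighbours of each as
    leaves. The predecessors discount the edge between the centres. *)
Lemma double_star_iso (G : sgraph) (a b : G) :
  edge a b ->
  (forall v, v != a -> v != b -> edge v =1 pred1 a \/ edge v =1 pred1 b) ->
  graph_iso G (double_star (degree a).-1 (degree b).-1).
Proof.
move=> ab leaf.
have neq_ab : a != b by apply: contraTneq ab => ->; rewrite edge_irrefl.
pose A := [set v | edge a v] :\ b; pose B := [set v | edge b v] :\ a.
have cardA : (degree a).-1 = #|A|.
  rewrite -[degree a](@eq_card _ [set v | edge a v]) => [|v]; last by rewrite !inE.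
  by rewrite (cardsD1 b) inE ab.
have cardB : (degree b).-1 = #|B|.
  rewrite -[degree b](@eq_card _ [set v | edge b v]) => [|v]; last by rewrite !inE.
  by rewrite (cardsD1 a) inE edge_sym ab.
rewrite cardA cardB; apply: graph_iso_sym.
have AP v : v \in A -> [/\ v != a, v != b & edge v =1 pred1 a].
  rewrite !inE => /andP[vb av].
  have va : v != a by apply: contraTneq av => ->; rewrite edge_irrefl.
  split=> //; case: (leaf v va vb) => // vE.
  by have := vE a; rewrite edge_sym av /= (negPf neq_ab).
have BP v : v \in B -> [/\ v != a, v != b & edge v =1 pred1 b].
  rewrite !inE => /andP[va bv].
  have vb : v != b by apply: contraTneq bv => ->; rewrite edge_irrefl.
  split=> //; case: (leaf v va vb) => // vE.
  by have := vE b; rewrite edge_sym bv /= eq_sym (negPf neq_ab).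
pose g (x : double_star #|A| #|B|) : G :=
  match x with
  | inl None => a | inl (Some i) => enum_val i
  | inr None => b | inr (Some i) => enum_val i
  end.
have gE : {mono g : x y / edge x y}.
  (* Edges at a leaf are settled first; by symmetry only pairs of centres are then left. *)
  have gA (i : 'I_#|A|) y : edge (enum_val i) (g y) = (y == inl None).
    have [_ _ ->] := AP _ (enum_valP i).
    case: y => [[j|]|[j|]] /=; rewrite ?eqxx // ?[b == a]eq_sym ?(negPf neq_ab) //.
      by have [/negPf->] := AP _ (enum_valP j).
    by have [/negPf->] := BP _ (enum_valP j).
  have gB (i : 'I_#|B|) y : edge (enum_val i) (g y) = (y == inr None).
    have [_ _ ->] := BP _ (enum_valP i).
    case: y => [[j|]|[j|]] /=; rewrite ?eqxx // ?(negPf neq_ab) //.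
      by have [_ /negPf->] := AP _ (enum_valP j).
    by have [_ /negPf->] := BP _ (enum_valP j).
  move=> [[i|]|[i|]] y; rewrite ?gA ?gB; last 1 first.
  - case: y => [[j|]|[j|]].
    + by rewrite edge_sym gA.
    + by rewrite edge_sym /= ab.
    + by rewrite edge_sym gB.
    + by rewrite /= edge_irrefl.
  - by case: y => [[j|]|[j|]] //=; rewrite /added_edge /= ?andbF.
  - case: y => [[j|]|[j|]].
    + by rewrite edge_sym gA.
    + by rewrite /= edge_irrefl.
    + by rewrite edge_sym gB.
    + by rewrite /= ab.
  - by case: y => [[j|]|[j|]] //=; rewrite /added_edge /= ?andbF.
(* This triple of tests tells the four kinds of vertices apart, so injectivity only has to be
   checked within one kind, where [enum_val] is injective. *)
have g_class x : (g x == a, g x == b, g x \in A) =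
    match x with
    | inl None => (true, false, false) | inr None => (false, true, false)
    | inl (Some _) => (false, false, true) | inr (Some _) => (false, false, false)
    end.
  case: x => [[i|]|[i|]] /=.
  - by have [/negPf-> /negPf-> _] := AP _ (enum_valP i); rewrite enum_valP.
  - by rewrite !inE eqxx edge_irrefl (negPf neq_ab) andbF.
  - have [/negPf-> /negPf-> iE] := BP _ (enum_valP i).
    by rewrite !inE edge_sym iE /= (negPf neq_ab) andbF.
  - by rewrite !inE eqxx eq_sym (negPf neq_ab).
have g_inj : injective g.
  move=> x y xy; have := g_class x; rewrite xy g_class.
  case: x y xy => [[i|]|[i|]] [[j|]|[j|]] //= xy _;
    by rewrite (enum_val_inj xy).
have g_codom v : v \in codom g.
  have [->|va] := eqVneq v a; first exact: (codom_f g (inl None)).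
  have [->|vb] := eqVneq v b; first exact: (codom_f g (inr None)).
  case: (leaf v va vb) => vE.
    have vA : v \in A by rewrite !inE vb edge_sym vE /= eqxx.
    rewrite -(enum_rankK_in vA vA).
    exact: (codom_f g (inl (Some (enum_rank_in vA v)))).
  have vB : v \in B by rewrite !inE va edge_sym vE /= eqxx.
  rewrite -(enum_rankK_in vB vB).
  exact: (codom_f g (inr (Some (enum_rank_in vB v)))).
exists g => //; exists (fun v => iinv (g_codom v)) => [x|v].
  by apply: g_inj; rewrite f_iinv.
by rewrite f_iinv.
Qed.

(** Monomials are matched with vertices one at a time: first [b], then [a]; every vertex left over
    must have degree 1. *)
Lemma double_star_of_coef (r t : nat) (G : sgraph) : 0 < r -> 0 < t -> 0 < #|G| ->
  ((da G)`_1 = (r + t)%:R * 'X^(r + t + 1) + 'X^(r + 1) + 'X^(t + 1)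
  /\ (da G)`_(r + t + 2) = 'X^(r + t + 3))%R ->
  graph_iso G (double_star r t).
Proof.
move=> r_gt0 t_gt0 G_gt0 []; rewrite coef_da1 => da1 dan.
(* At y = 1 each vertex contributes 1. *)
have cardG : #|G| = r + t + 2.
  have /eqP := congr1 (fun p : {poly int} => p.[1%R]%R) da1.
  rewrite horner_sum; under eq_bigr do rewrite hornerXn expr1n.
  rewrite sumr_const !hornerE !expr1n mulr1 hornerMn !hornerE !natr1 eqr_nat.
  by move=> /eqP->; lia.
(* Otherwise the top coefficient would be 0, whereas a power of y is monic. *)
have conG : connected G.
  move: dan; rewrite -cardG coef_da_card //; case: ifP => // _ /eqP.
  by rewrite eq_sym (negPf (monic_neq0 (monicXn _ _))).
(* Exponent r + 1 means degree t + 1. *)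
have [b _ deg_b] : exists2 v : G, xpredT v & #|G| - degree v = r + 1.
  apply: (sumXn_exists da1).
  rewrite mulr_natl !coefD coefMn !coefXn eqxx -mulrnA -!natrD pnatr_eq0; lia.
(* Cancelling the term of [b] before looking for [a] makes the two vertices distinct even when r =
   t. *)
have {}da1 : (\sum_(v | v != b) 'X^(#|G| - degree v) =
              (r + t)%:R * 'X^(r + t + 1) + 'X^(t + 1) :> {poly int})%R.
  rewrite (bigD1 b) //= deg_b in da1.
  by apply: (addrI 'X^(r + 1)%R); rewrite da1 addrA [X in (X + _)%R]addrC.
have [a neq_ab deg_a] : exists2 v : G, v != b & #|G| - degree v = t + 1.
  apply: (sumXn_exists da1).
  rewrite mulr_natl !coefD coefMn !coefXn eqxx -mulrnA -!natrD pnatr_eq0; lia.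
have {}da1 : (\sum_(v | (v != b) && (v != a)) 'X^(#|G| - degree v) =
              (r + t)%:R * 'X^(r + t + 1) :> {poly int})%R.
  rewrite (bigD1 a) //= deg_a in da1.
  by apply: (addrI 'X^(t + 1)%R); rewrite da1 addrC.
have leaf v : v != a -> v != b -> exists c, edge v =1 pred1 c.
  move=> va vb.
  have : degree v == 1.
    have := sumXn_coef_neq0 da1 (introT andP (conj vb va)).
    rewrite mulr_natl coefMn coefXn; case: (_ =P r + t + 1) => [|_].
      by have := degree_lt v; rewrite cardG; lia.
    by rewrite mul0rn eqxx.
  move=> /cards1P[c /setP vE]; exists c => w.
  by have := vE w; rewrite !inE.
(* Connectedness in the form used below: a nonempty set closed under adjacency contains every
   vertex. *)
have no_cut (D : {pred G}) u v : closed (@edge G) D -> u \in D -> v \in D.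
  by move=> /closed_connect clD; rewrite (clD u v) // (forallP (forallP conG u)).
have leafP v : v != a -> v != b -> edge v =1 pred1 a \/ edge v =1 pred1 b.
  move=> va vb; have [c vE] := leaf v va vb.
  have [<-|ca] := eqVneq c a; first by left.
  have [<-|cb] := eqVneq c b; first by right.
  (* If the neighbour [c] of [v] were a leaf too, the pair of them would be closed under adjacency
     and yet miss [a]. *)
  have [d cE] := leaf c ca cb.
  have dv : d = v by apply/esym/eqP; rewrite -[_ == _]cE edge_sym vE /= eqxx.
  suff : a \in pred2 v c by rewrite inE ![a == _]eq_sym (negPf va) (negPf ca).
  apply: (no_cut _ v); last by rewrite inE eqxx.
  apply: intro_closed => [|x y xy /pred2P[] xE]; first exact/sym_connect_sym/edge_sym.
    by move: xy; rewrite xE vE => /eqP->; rewrite inE eqxx orbT.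
  by move: xy; rewrite xE cE dv => /eqP->; rewrite inE eqxx.
have ab : edge a b.
  apply: contraT => /negPf nab.
  suff : b \in [pred v | (v == a) || edge a v] by rewrite inE eq_sym (negPf neq_ab) nab.
  apply: (no_cut _ a); last by rewrite inE eqxx.
  apply: intro_closed => [|x y xy]; first exact/sym_connect_sym/edge_sym.
  rewrite !inE => /orP[/eqP <-|ax]; first by rewrite xy orbT.
  (* A neighbour [x] of [a] is not [b] by assumption, hence a leaf, and its only neighbour is [a];
     no edge leaves the set. *)
  have xa : x != a by apply: contraTneq ax => ->; rewrite edge_irrefl.
  have xb : x != b by apply: contraTneq ax => ->; rewrite nab.
  have [c xE] := leaf x xa xb.
  have /eqP ac : a == c by rewrite -[_ == _]xE edge_sym.
  by rewrite ac -[_ == _]xE xy.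
have := double_star_iso ab leafP.
have -> : (degree a).-1 = r by have := degree_lt a; lia.
by have -> : (degree b).-1 = t by have := degree_lt b; lia.
Qed.

Theorem proposition26 (r t : nat) (r_gt0 : 0 < r) (t_gt0 : 0 < t)
    (G : sgraph) (G_gt0 : 0 < #|G|) :
  graph_iso G (double_star r t) <->
  ((da G)`_1 = (r + t)%:R * 'X^(r + t + 1) + 'X^(r + 1) + 'X^(t + 1)
   /\ (da G)`_(r + t + 2) = 'X^(r + t + 3))%R.
Proof.
by split; [apply: double_star_coef | apply: double_star_of_coef].
Qed.
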